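(* Let $G$ be a finite graph and $\mathcal L$ a non-trivial linear class of bonds of $G$. Then the circuits of the join matroid $J(G,\mathcal L)$ are exactly: (1) the edge sets of $\mathcal L$-joins, and (2) the edge sets of cycles of $G$ that do not contain an $\mathcal L$-join.
   Context: Graphs are finite, loops and multiple edges allowed. A bond is a minimal nonempty edge cut; $\delta(X)$ is the set of links with exactly one endpoint in a vertex set $X$. A tribond is $\delta(X_1)\cup\delta(X_2)\cup\delta(X_3)$ for a partition $\{X_1,X_2,X_3\}$ of the vertex set of one connected component into nonempty sets with each $G[X_i]$ connected and an edge joining each pair. A linear class of bonds is a set $\mathcal L$ of bonds such that for each such tripartition the number of $i$ with $\delta(X_i)\in\mathcal L$ is never exactly two; it is trivial if it contains every bond; bonds in $\mathcal L$ are cobalanced. A modular pair of bonds $B_1,B_2$ is one for which $G-(B_1\cup B_2)$ has two more components than $G$; a dibond is the union of a modular pair that is not a tribond. For non-trivial $\mathcal L$, $J_0(G,\mathcal L)$ is the matroid on $E(G)\cup\{e_0\}$ whose cocircuits are the bonds in $\mathcal L$, the sets $B\cup\{e_0\}$ for bonds $B\notin\mathcal L$, and the tribonds and dibonds containing no bond of $\mathcal L$; $J(G,\mathcal L)=J_0(G,\mathcal L)/e_0$. For $F\subseteq E(G)$, $\pi_F$ is the partition of $V(G)$ into vertex sets of the components of $(V(G),F)$; $\mathrm{Ext}(\pi)$ is the set of edges whose endpoints lie in different parts of $\pi$; $\pi$ is cobalanced if every bond contained in $\mathrm{Ext}(\pi)$ lies in $\mathcal L$. An $\mathcal L$-join is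 the edge set $J$ of a forest of $G$ such that $\pi_J$ is cobalanced and $J$ is minimal (under inclusion) among forests with this property. *)

(* Defs.v *)
From mathcomp Require Import all_boot.
From mathcomp Require Import zify.

Set Implicit Arguments.
Unset Strict Implicit.
Unset Printing Implicit Defensive.

(** * Matroids on a finite type, given by their rank function *)

Record matroid (T : finType) := Matroid {
  rk :> {set T} -> nat;
  rk_le_card : forall X, rk X <= #|X|;
  rk_mono : forall X Y : {set T}, X \subset Y -> rk X <= rk Y;
  rk_submod : forall X Y, rk (X :|: Y) + rk (X :&: Y) <= rk X + rk Y
}.

Section MatroidTheory.
Variable T : finType.
Implicit Types (M : matroid T) (X Y C : {set T}).

Definition indep M X := M X == #|X|.

Definition circuit M C := minset (fun X => ~~ indep M X) C.

(* r*(X) = |X| - r(M) + r(E - X), arranged so that the truncated subtraction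
   is exact by [rk_setT_le]. *)
Definition dual_rk M X := #|X| + M (~: X) - M setT.

Lemma rk_setT_le M X : M setT <= #|X| + M (~: X).
Proof.
have := rk_submod M X (~: X); rewrite setUCr.
have := rk_le_card M X; lia.
Qed.

Lemma dual_rk_le_card M X : dual_rk M X <= #|X|.
Proof.
have := rk_mono M (subsetT (~: X)); rewrite /dual_rk; lia.
Qed.

Lemma dual_rk_mono M X Y : X \subset Y -> dual_rk M X <= dual_rk M Y.
Proof.
move=> sXY; rewrite /dual_rk.
have := rk_submod M (~: Y) (Y :\: X).
have -> : ~: Y :|: (Y :\: X) = ~: X.
  apply/setP=> x; rewrite !inE; have := subsetP sXY x.
  by case: (x \in X); case: (x \in Y) => // /(_ isT).
have := rk_le_card M (Y :\: X); have := cardsID X Y.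
rewrite (setIidPr sXY); lia.
Qed.

Lemma dual_rk_submod M X Y :
  dual_rk M (X :|: Y) + dual_rk M (X :&: Y) <= dual_rk M X + dual_rk M Y.
Proof.
rewrite /dual_rk setCU setCI.
have := rk_submod M (~: X) (~: Y).
have := cardsUI X Y.
have := rk_setT_le M X; have := rk_setT_le M Y.
have := rk_setT_le M (X :|: Y); rewrite setCU.
have := rk_setT_le M (X :&: Y); rewrite setCI; lia.
Qed.

Definition dual M : matroid T :=
  Matroid (@dual_rk_le_card M) (@dual_rk_mono M) (@dual_rk_submod M).

Definition cocircuit M C := circuit (dual M) C.

End MatroidTheory.

(** * Contraction of the extra element [None] of a matroid on [option T] *)

Section Contraction.
Variables (T : finType) (M : matroid (option T)).
Implicit Types X Y : {set T}.

Definition contract_rk X := M (None |: Some @: X) - M [set None].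

Lemma rk_None_le X : M [set None] <= M (None |: Some @: X).
Proof. exact/rk_mono/subsetUl. Qed.

Lemma contract_rk_le_card X : contract_rk X <= #|X|.
Proof.
have := rk_submod M [set None] (Some @: X).
have := rk_le_card M (Some @: X); rewrite card_imset; last by move=> x y [].
move=> leSX leU; rewrite /contract_rk leq_subLR.
by apply: leq_trans (leq_trans (leq_addr _ _) leU) _; rewrite leq_add2l.
Qed.

Lemma contract_rk_mono X Y : X \subset Y -> contract_rk X <= contract_rk Y.
Proof. by move=> sXY; apply/leq_sub2r/rk_mono/setUS/imsetS. Qed.

Lemma contract_rk_submod X Y :
  contract_rk (X :|: Y) + contract_rk (X :&: Y)
    <= contract_rk X + contract_rk Y.
Proof.
have arith a b c d z : z <= a -> z <= b -> z <= c -> z <= d ->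
  c + d <= a + b -> (c - z) + (d - z) <= (a - z) + (b - z) by lia.
apply: arith; do ?exact: rk_None_le.
have := rk_submod M (None |: Some @: X) (None |: Some @: Y).
by rewrite -setUUr -imsetU -setUIr -imsetI // => x y _ _ [].
Qed.

Definition contract : matroid T :=
  Matroid contract_rk_le_card contract_rk_mono contract_rk_submod.

End Contraction.

(** * Finite graphs, with loops and multiple edges *)

(* The order of the two endpoints in [ends e] carries no meaning. *)
Record graph := Graph {
  vertex : finType;
  edge : finType;
  ends : edge -> vertex * vertex
}.

Section GraphTheory.
Variable G : graph.
Local Notation V := (vertex G).
Local Notation E := (edge G).
Implicit Types (e : E) (F B C J : {set E}) (X Y K : {set V})
  (P pi : {set {set V}}) (L : {set {set E}}).

Definition joins e (u v : V) :=
  (ends e == (u, v)) || (ends e == (v, u)).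

Definition adj F : rel V := fun u v => [exists e in F, joins e u v].

(* pi_F, the partition of the vertex set into the components of (V(G), F) *)
Definition components F : {set {set V}} :=
  equivalence_partition (connect (adj F)) [set: V].

Definition delta X : {set E} :=
  [set e | ((ends e).1 \in X) != ((ends e).2 \in X)].

Definition edge_cut B := [exists X, B == delta X].

Definition bond B := minset (fun B' => (B' != set0) && edge_cut B') B.

Definition induced_edges X : {set E} :=
  [set e | ((ends e).1 \in X) && ((ends e).2 \in X)].

(* G[X] is connected; the path stays in X since its edges lie within X *)
Definition connected_on X :=
  (X != set0) &&
  [forall u in X, forall v in X, connect (adj (induced_edges X)) u v].

(* MathComp's [partition] requires the parts to be nonempty. *)
Definition tripartition P :=
  [&& [exists K in components [set: E], partition P K],
      #|P| == 3,
      [forall X in P, connected_on X] &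
      [forall X in P, forall Y in P, (X != Y) ==>
         [exists e, exists u in X, exists v in Y, joins e u v]]].

Definition tribond B :=
  [exists P, tripartition P && (B == \bigcup_(X in P) delta X)].

Definition linear_class L :=
  [forall B in L, bond B] &&
  [forall P, tripartition P ==> (#|[set X in P | delta X \in L]| != 2)].

Definition trivial_class L := [forall B, bond B ==> (B \in L)].

Definition modular_pair B1 B2 :=
  [&& bond B1, bond B2 &
      #|components (~: (B1 :|: B2))| == #|components [set: E]| + 2].

Definition dibond B :=
  [exists B1, exists B2, modular_pair B1 B2 && (B == B1 :|: B2)]
  && ~~ tribond B.

(** ** The matroid J_0(G, L); the element e_0 is [None : option E] *)

Definition J0_cocircuit L (D : {set option E}) :=
  [|| [exists B in L, D == Some @: B],
      [exists B, [&& bond B, B \notin L & D == None |: Some @: B]] |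
      [exists B, [&& tribond B || dibond B,
                     [forall B' in L, ~~ (B' \subset B)] &
                     D == Some @: B]]].

(* A matroid is determined by its cocircuits, so at most one matroid (up to
   pointwise equality of rank functions) satisfies this. *)
Definition is_J0 L (M : matroid (option E)) :=
  forall D, cocircuit M D = J0_cocircuit L D.

(** ** Cycles, forests and joins *)

(* C = {e_1, ..., e_k} with k > 0, where e_i joins v_i and v_(i+1) (indices
   cyclic) and the v_i as well as the e_i are pairwise distinct.  A loop is a
   cycle with k = 1, and two parallel edges form one with k = 2. *)
Definition is_cycle C :=
  exists s : seq (V * E),
    [/\ s != [::],
        uniq [seq p.1 | p <- s],
        uniq [seq p.2 | p <- s],
        cycle (fun p q => joins p.2 p.1 q.1) s &
        C = [set e in [seq p.2 | p <- s]]].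

Definition is_forest F := forall C, is_cycle C -> ~ (C \subset F).

Definition Ext pi : {set E} :=
  [set e | pblock pi (ends e).1 != pblock pi (ends e).2].

Definition cobalanced L pi :=
  [forall B, bond B && (B \subset Ext pi) ==> (B \in L)].

Definition is_join L J :=
  [/\ is_forest J,
      cobalanced L (components J) &
      forall J', is_forest J' -> cobalanced L (components J') ->
        J' \subset J -> J' = J].

End GraphTheory.

(* Main.v *)
(** Since a non-loop [e] lies outside the closure of [X] exactly when some
    cocircuit through [e] avoids [X], everything is read off the cocircuits.
    Up to [e_0], every cocircuit of J_0 is a union of bonds and every bond is a
    cocircuit, so J_0 \ e_0 is the graphic matroid: its independent sets are
    the forests.  The cocircuits through [e_0] are the [B + e_0] with [B] a bond
    outside L, so [e_0] is spanned by [F] exactly when pi_F is cobalanced.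
    Hence a set is independent in J = J_0 / e_0 iff it is a forest whose
    partition is not cobalanced, and the circuits are the minimal sets that
    violate this. *)
Require Import Defs.
From mathcomp Require Import all_boot.
From mathcomp Require Import zify.

Set Implicit Arguments.
Unset Strict Implicit.
Unset Printing Implicit Defensive.

(** * Independence read off the cocircuits *)

Section MatroidCocircuits.
Variables (T : finType) (M : matroid T).
Implicit Types (X Y D H : {set T}) (x y : T).

Lemma rk_setU1_le x X : M (x |: X) <= (M X).+1.
Proof.
have := rk_submod M [set x] X; have := rk_le_card M [set x].
rewrite cards1; lia.
Qed.

(** By submodularity, [y] adds no more rank to a superset of [X] than to [X]; so a maximal superset
    of the same rank is everything. *)
Lemma rk_setU1_stable X :
  (forall y, M (y |: X) = M X) -> M setT = M X.
Proof.
move=> stX; have [Y /maxsetP[/andP[sXY /eqP rkY] maxY] _] :=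
  @maxset_exists _ (fun Y => (X \subset Y) && (M Y == M X)) X
    (introT andP (conj (subxx X) (eqxx _))).
suff -> : [set: T] = Y by [].
apply/setP=> y; rewrite inE; apply/esym/idPn=> yY.
suff /maxY : (X \subset y |: Y) && (M (y |: Y) == M X).
  by move=> /(_ (subsetUr _ _))/setP/(_ y); rewrite setU11 (negPf yY).
rewrite (subset_trans sXY (subsetUr _ _)) /= eqn_leq andbC.
rewrite rk_mono ?(subset_trans sXY) ?subsetUr //=.
have := rk_submod M Y (y |: X).
have := rk_mono M (_ : X \subset Y :&: (y |: X)).
rewrite subsetI sXY subsetUr => /(_ isT).
rewrite setUCA (setUidPl sXY) stX; lia.
Qed.

(** Cocircuits are complements of hyperplanes: a set is dependent in the dual exactly when its
    complement does not span, so minimality of [D] is maximality of [~: D]. *)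
Lemma cocircuitP D :
  reflect (M (~: D) < M setT /\ forall y, y \in D -> M (y |: ~: D) = M setT)
          (cocircuit M D).
Proof.
have codepE X : ~~ indep (dual M) X = (M (~: X) < M setT).
  rewrite /indep /= /dual_rk.
  have := rk_setT_le M X; have := rk_mono M (subsetT (~: X)); lia.
have rkT X : M X <= M setT by apply/rk_mono/subsetT.
apply: (iffP minsetP); rewrite codepE => -[ltD minD]; split=> //.
  move=> y yD; have := rkT (y |: ~: D); rewrite leq_eqVlt => /orP[/eqP //|lt].
  have /minD : ~~ indep (dual M) (D :\ y) by rewrite codepE setCD setUC.
  by move/(_ (subsetDl _ _))/setP/(_ y); rewrite !inE eqxx yD.
move=> D'; rewrite codepE => ltD' sD'D; apply/eqP; rewrite eqEsubset sD'D /=.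
apply/subsetP=> y yD; apply/idPn=> yD'; move: ltD'; rewrite ltnNge.
rewrite -(minD y yD) rk_mono // subUset sub1set inE yD' /=.
by rewrite setCS.
Qed.

(** Submodularity for [X] and the hyperplane [~: D]: their union spans, and their intersection is
    [X :\ x]. *)
Lemma cocircuit_rk_ltn D X x :
  cocircuit M D -> D :&: X = [set x] -> M (X :\ x) < M X.
Proof.
move=> /cocircuitP[ltD minD] DX.
have /setIP[xD xX] : x \in D :&: X by rewrite DX set11.
have := rk_submod M X (~: D).
have -> : X :&: ~: D = X :\ x.
  apply/setP=> y; move/setP/(_ y): DX; rewrite !inE.
  by case: (y \in D); case: (y \in X) => //= <-.
have := rk_mono M (_ : x |: ~: D \subset X :|: ~: D).
by rewrite setSU ?sub1set // => /(_ isT); rewrite minD //; lia.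
Qed.

(** A maximal [H] containing [X :\ x] without spanning [x] is a hyperplane, and its complement is
    the cocircuit. *)
Lemma rk_ltn_cocircuit X x : x \in X -> M (X :\ x) < M X ->
  exists2 D, cocircuit M D & D :&: X = [set x].
Proof.
move=> xX lt.
have [H /maxsetP[ltH maxH] sXH] :
    {H | maxset (fun H => M H < M (x |: H)) H & X :\ x \subset H}.
  by apply: maxset_exists; rewrite setD1K.
have xH : x \notin H.
  by apply: contraL ltH => xH; rewrite (setUidPr _) ?sub1set ?ltnn.
(* By maximality, any [y] added to [H] from outside brings [x] into the span. *)
have rkx y : M (x |: (y |: H)) = M (y |: H) \/ y \in H.
  have [yH|yH] := boolP (y \in H); first by right.
  left; apply/eqP; rewrite eqn_leq (rk_mono _ (subsetUr _ _)) andbT leqNgt.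
  apply: contra yH => /maxH/(_ (subsetUr _ _)) eqH; by rewrite -eqH setU11.
have rkH y : y \notin H -> M (y |: H) = M (x |: H).
  move=> yH; have [rky|] := rkx y; last by rewrite (negPf yH).
  have := rk_setU1_le y H.
  have := rk_mono M (setUS [set x] (subsetUr [set y] H)).
  by rewrite rky; lia.
have rkT : M setT = M (x |: H).
  apply: rk_setU1_stable => y; have [yH|yH] := boolP (y \in H).
    by rewrite (setUidPr _) // sub1set inE yH orbT.
  rewrite setUCA; have [->|] := rkx y; first exact: rkH.
  by rewrite (negPf yH).
exists (~: H).
  apply/cocircuitP; rewrite setCK rkT; split=> // y; rewrite inE; exact: rkH.
apply/setP=> y; rewrite !inE; have [->|yx] := eqVneq y x; first by rewrite xH.
apply/andP=> -[yH yX]; case/negP: yH.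
by apply: (subsetP sXH); rewrite !inE yx.
Qed.

Lemma indep_cocircuitP X :
  indep M X <->
  (forall x, x \in X -> exists2 D, cocircuit M D & D :&: X = [set x]).
Proof.
split=> [/eqP rkX x xX|].
  apply: rk_ltn_cocircuit => //; have := rk_le_card M (X :\ x).
  by have := cardsD1 x X; rewrite xX rkX; lia.
have [n] := ubnP #|X|; elim: n X => // n IH X ltX cocX.
rewrite /indep eqn_leq rk_le_card /=.
have [->|[x xX]] := set_0Vmem X; first by rewrite cards0.
have [D cD DX] := cocX x xX; have := cocircuit_rk_ltn cD DX.
have := cardsD1 x X; rewrite xX => cX.
have /eqP-> : indep M (X :\ x); last by lia.
apply: IH => [|y /setD1P[yx yX]]; first by lia.
have [D' cD' D'X] := cocX y yX; exists D' => //.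
rewrite setIDA D'X; apply/setP=> z; rewrite !inE.
by case: eqVneq => // ->; rewrite eq_sym (negPf yx).
Qed.

(** With [None] for [x], this splits independence in the contraction into a condition on edges and
    one on the cocircuits through $e_0$. *)
Lemma indep_setU1P X x : x \notin X ->
  indep M (x |: X) <->
  indep M X /\ exists2 D, cocircuit M D & D :&: (x |: X) = [set x].
Proof.
move=> xX; have cX : #|x |: X| = #|X|.+1 by rewrite cardsU1 xX.
have XK : (x |: X) :\ x = X by rewrite setU1K.
have leX := rk_le_card M X; have leU := rk_setU1_le x X.
split=> [indU|[/eqP rkX [D cD DX]]].
  split; last by apply: (indep_cocircuitP _).1 => //; exact: setU11.
  by move/eqP: indU; rewrite /indep cX; lia.
have := cocircuit_rk_ltn cD DX; rewrite XK /indep cX; lia.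
Qed.

End MatroidCocircuits.

Lemma indep_contract (T : finType) (M : matroid (option T)) (X : {set T}) :
  indep M [set None] ->
  indep (contract M) X = indep M (None |: Some @: X).
Proof.
rewrite /indep /= /contract_rk cards1 => /eqP rk0.
have := rk_None_le M X; rewrite rk0.
rewrite cardsU1 card_imset; last by move=> x y [].
have -> : None \notin Some @: X by apply/imsetP=> -[].
lia.
Qed.

(** * Edge cuts, bonds and cobalanced partitions *)

Section Cuts.
Variable G : graph.
Implicit Types (e : edge G) (F B C : {set edge G}) (X Y : {set vertex G}).

Lemma joins_delta e u v Y :
  joins e u v -> (e \in delta Y) = ((u \in Y) != (v \in Y)).
Proof. by rewrite inE => /orP[] /eqP-> //=; rewrite eq_sym. Qed.

Lemma joins_ends e : joins e (ends e).1 (ends e).2.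
Proof. by rewrite /joins -surjective_pairing eqxx. Qed.

Lemma adj_sym F : symmetric (adj F).
Proof. by move=> u v; apply: eq_existsb => e; rewrite /joins orbC. Qed.

Lemma connect_delta F Y u v :
  delta Y :&: F = set0 -> connect (adj F) u v -> (u \in Y) = (v \in Y).
Proof.
move=> dis; apply: closed_connect => a b /exists_inP[e eF jab].
apply/eqP; move/setP/(_ e): dis.
by rewrite in_setI eF andbT (joins_delta _ jab) in_set0 => /negbFE.
Qed.

(** For nested cuts the difference is the symmetric difference, which is the cut of the symmetric
    difference of the sides. *)
Lemma edge_cut_diff B C :
  edge_cut B -> edge_cut C -> B \subset C -> edge_cut (C :\: B).
Proof.
move=> /existsP[X /eqP->] /existsP[Y /eqP->] /subsetP sXY; apply/existsP.
exists ((X :|: Y) :\: (X :&: Y)); apply/eqP/setP=> e.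
move/(_ e): sXY; rewrite !inE.
case: (_ \in X); case: (_ \in Y); case: (_ \in X); case: (_ \in Y) => //=;
  by move=> /(_ isT).
Qed.

Lemma bond_cut B : bond B -> edge_cut B.
Proof. by case/minsetP=> /andP[]. Qed.

(* A minimal cut through [e] is a bond: otherwise removing from it a bond that
   avoids [e] would leave a smaller cut through [e]. *)
Lemma edge_cut_bond C e :
  edge_cut C -> e \in C -> exists B, [/\ bond B, e \in B & B \subset C].
Proof.
move=> cutC eC; have [A /minsetP[/andP[eA cutA] minA] sAC] :=
  @minset_exists _ (fun A => (e \in A) && edge_cut A) C
    (introT andP (conj eC cutC)).
have [|B bB sBA] := @minset_exists _ (fun B => (B != set0) && edge_cut B) A.
  by rewrite cutA andbT; apply/set0Pn; exists e.
have [/andP[/set0Pn[f fB] cutB] _] := minsetP bB.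
have eB : e \in B.
  apply: contraT => eB; have : A :\: B = A.
    by apply: minA; rewrite ?subsetDl // inE eB eA edge_cut_diff.
  by move/setP/(_ f); rewrite inE fB (subsetP sBA).
by exists B; split=> //; apply: subset_trans sAC.
Qed.

(** A cut that avoids [F] has each component of [F] on one side, so its edges run between
    components. *)
Lemma bond_Ext F B :
  bond B -> (B \subset Ext (components F)) = (B :&: F == set0).
Proof.
move=> /bond_cut/existsP[Y /eqP->].
have eqV : {in [set: vertex G] & &, equivalence_rel (connect (adj F))}.
  suff eqv : equivalence_rel (connect (adj F)) by apply: in3W.
  apply/equivalence_relP; split; first exact: connect0.
  exact/same_connect/sym_connect_sym/adj_sym.
have ExtE e :
    (e \in Ext (components F)) = ~~ connect (adj F) (ends e).1 (ends e).2.
  have [/eqP cov triv _] := and3P (equivalence_partitionP eqV).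
  rewrite inE eq_pblock ?cov ?inE //.
  by rewrite pblock_equivalence_partition ?inE.
apply/subsetP/eqP=> [sub|dis e].
  apply/setP=> e; rewrite in_setI in_set0; apply/andP=> -[/sub eExt eF].
  move: eExt; rewrite ExtE => /negP[]; apply: connect1.
  by apply/exists_inP; exists e; rewrite ?joins_ends.
rewrite ExtE inE; apply: contra => /(connect_delta dis)->; exact: eqxx.
Qed.

Lemma cobalancedP (L : {set {set edge G}}) F :
  reflect (forall B, bond B -> B :&: F = set0 -> B \in L)
          (cobalanced L (components F)).
Proof.
apply: (iffP forall_inP) => cob B.
  by move=> bB /eqP dis; apply: cob; rewrite bB bond_Ext.
by case/andP=> bB; rewrite bond_Ext // => /eqP; apply: cob.
Qed.

End Cuts.

(** * Forests, bridges and cycles *)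

Section Forests.
Variable G : graph.
Implicit Types (e : edge G) (F B C : {set edge G}) (X Y : {set vertex G}).

(* [F] has no cycle iff each of its edges is a bridge of it, and a bridge is
   witnessed by a cut that meets [F] in that edge alone. *)
Definition forestb F :=
  [forall e in F, [exists Y : {set vertex G}, delta Y :&: F == [set e]]].

Lemma forestb_sub F F' : F' \subset F -> forestb F -> forestb F'.
Proof.
move=> /subsetP sF'F /forall_inP forF; apply/forall_inP=> e eF'.
have /existsP[Y /eqP YF] := forF e (sF'F _ eF').
apply/existsP; exists Y; apply/eqP/setP=> f; move/setP/(_ f): YF.
rewrite !in_setI !in_set1; have [->|_] := eqVneq f e.
  by rewrite eF' => /andP[->].
by case: (boolP (f \in F')) => [/sF'F->|]; rewrite ?andbF.
Qed.

Local Notation step := (fun p q : vertex G * edge G => joins p.2 p.1 q.1).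

Lemma is_cycle_rot C e : is_cycle C -> e \in C ->
  exists v s, [/\ uniq [seq p.1 | p <- (v, e) :: s],
                  uniq [seq p.2 | p <- (v, e) :: s],
                  cycle step ((v, e) :: s) &
                  C = [set f in [seq p.2 | p <- (v, e) :: s]]].
Proof.
move=> [s [_ u1 u2 cyc ->]]; rewrite inE => /mapP[[v f] ps ef].
have {ef}-> : e = f by [].
have [i s' rs] := rot_to ps; exists v, s'.
by rewrite -rs rot_cycle !map_rot !rot_uniq; split=> //; apply/setP=> g;
  rewrite !inE mem_rot.
Qed.

(** The edge of the last pair leads beyond the path, so only the pairs of [belast q s] must avoid
    the cut. *)
Lemma step_path_side Y q s :
  path step q s -> (forall p, p \in belast q s -> p.2 \notin delta Y) ->
  (q.1 \in Y) = ((last q s).1 \in Y).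
Proof.
elim: s q => //= r s IH q /andP[qr pth] nY.
rewrite -(IH r) // => [|p ps]; last by apply: nY; rewrite inE ps orbT.
by apply/eqP; have := nY q (mem_head _ _); rewrite (joins_delta _ qr) negbK.
Qed.

(** A cycle cannot cross a cut exactly once: the rest of the cycle would link the ends of [e] on one
    side. *)
Lemma forestb_acyclic F : forestb F -> is_forest F.
Proof.
move=> /forall_inP forF C cC /subsetP sCF.
have [e eC] : exists e, e \in C.
  case: cC => [[|[v e] s] [] // _ _ _ _ ->].
  by exists e; rewrite inE mem_head.
have /existsP[Y /eqP YF] := forF e (sCF _ eC).
have [v [s [_ /=/andP[es _] cyc defC]]] := is_cycle_rot cC eC.
(* A cycle of length one is a loop, which lies in no cut. *)
case: s => [|q s] in es cyc defC.
  have : e \in delta Y by move/setP/(_ e): YF; rewrite in_setI set11 => /andP[].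
  by move: cyc => /=; rewrite andbT => /(joins_delta Y)->; rewrite eqxx.
move: cyc => /= /andP[vq pth].
have eY : e \in delta Y by move/setP/(_ e): YF; rewrite in_setI set11 => /andP[].
move: eY; rewrite (joins_delta Y vq) (step_path_side (Y := Y) pth).
  by rewrite last_rcons eqxx.
move=> p; rewrite belast_rcons => pqs; apply/negP=> pY.
have psnd : p.2 \in [seq p.2 | p <- q :: s] by apply: map_f.
have : p.2 \in delta Y :&: F.
  by rewrite in_setI pY sCF // defC inE map_cons inE psnd orbT.
by rewrite YF inE => /eqP pe; rewrite -pe psnd in es.
Qed.

(** Chooses edges along a simple path. The clause on endpoints makes them distinct in the induction;
    the last clause lets a further edge close the path to a cycle. *)
Lemma path_step F u p : path (adj F) u p -> uniq (u :: p) ->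
  exists s : seq (vertex G * edge G),
    [/\ [seq q.1 | q <- s] = belast u p,
        uniq [seq q.2 | q <- s],
        {subset [seq q.2 | q <- s] <= F},
        (forall e, e \in [seq q.2 | q <- s] ->
           forall a b, joins e a b -> a \in u :: p) &
        (forall q r, joins q.2 q.1 u -> r.1 = last u p ->
           path step q (rcons s r))].
Proof.
elim: p u => [|w p IH] u; first by exists [::]; split=> //= q r qu ->; rewrite qu.
rewrite [path _ _ _]/= => /andP[/exists_inP[e eF jue] pth].
rewrite cons_uniq => /andP[uwp uniq_wp].
have [s [s1 s2 sF sV sp]] := IH w pth uniq_wp.
exists ((u, e) :: s); split=> /=.
- by rewrite s1.
- rewrite s2 andbT; apply/negP=> es; case/negP: uwp; exact: sV es _ _ jue.
- by move=> f; rewrite inE => /predU1P[->|/sF].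
- move=> f; rewrite inE => /predU1P[-> a b jab|fs a b jab].
    move: jue jab; rewrite /joins => /orP[] /eqP-> /orP[] /eqP[-> ->];
    by rewrite !inE eqxx ?orbT.
  by rewrite inE (sV f fs a b jab) orbT.
- by move=> q r qu rl; rewrite qu /=; apply: sp.
Qed.

Lemma not_forestb_cycle F :
  ~~ forestb F -> exists2 C, is_cycle C & C \subset F.
Proof.
move=> /forall_inPn[e eF nsep]; pose F' := F :\ e.
have [cne|nce] := boolP (connect (adj F') (ends e).2 (ends e).1); last first.
  (* If [e] is a bridge, the component of one end in [F'] gives a cut that meets [F] in [e] alone;
     otherwise [e] closes a simple path in [F']. *)
  case/negP: nsep; apply/existsP; exists [set v | connect (adj F') (ends e).2 v].
  apply/eqP/setP=> f; rewrite in_setI in_set1.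
  have [->|fe] := eqVneq f e; first by rewrite !inE connect0 (negPf nce) eF.
  apply/andP=> -[]; rewrite !inE => /eqP nf fF; case: nf.
  apply: (same_connect_r (sym_connect_sym (@adj_sym _ F'))).
  apply: connect1; apply/exists_inP; exists f; rewrite ?joins_ends //.
  by rewrite !inE fe.
have [p pth lst] := connectP cne; case: (shortenP pth) lst => p' pth' up _ lst.
have [s [s1 s2 sF _ sp]] := path_step pth' up.
exists [set f in [seq q.2 | q <- ((ends e).1, e) :: s]].
  exists (((ends e).1, e) :: s); split=> //=.
  - move: up; rewrite lastI rcons_uniq -lst s1; by [].
  - rewrite s2 andbT; apply/negP=> /sF; by rewrite !inE eqxx.
  - exact/sp/lst/joins_ends.
apply/subsetP=> f; rewrite !inE => /predU1P[->//|/sF].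
by rewrite inE => /andP[].
Qed.

Lemma forestP F : reflect (is_forest F) (forestb F).
Proof.
apply: (iffP idP) => [|forF]; first exact: forestb_acyclic.
by apply: contraT => /not_forestb_cycle[C /forF].
Qed.

(** Without [e] the cycle is a path, and each initial segment of its vertices has a cut that meets
    the path in one edge. *)
Lemma cycle_minimal C e : is_cycle C -> e \in C -> forestb (C :\ e).
Proof.
move=> cC eC; have [v [s [u1 _ cyc ->]]] := is_cycle_rot cC eC.
(* Listing the pair of [e] last leaves the other edges at the positions [i] with [i.+1 < size t],
   between consecutive vertices. *)
set z := (v, e); pose t := rcons s z.
have tE : t = rot 1 (z :: s) by rewrite rot1_cons.
have {cyc} srt : sorted step t.
  by move: cyc; rewrite /= -/t; apply: path_sorted.
have {}u1 : uniq [seq p.1 | p <- t] by rewrite tE map_rot rot_uniq.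
have memt f : f \in [set f in [seq p.2 | p <- z :: s]] :\ e ->
    exists i, i.+1 < size t /\ f = (nth z t i).2.
  rewrite in_setD1 in_set -(mem_rot 1) -map_rot -tE.
  move=> /andP[fe /mapP[q qt fq]].
  exists (index q t); split; last by rewrite nth_index.
  rewrite ltn_neqAle index_mem qt andbT; apply: contra fe => /eqP iq.
  rewrite fq -(nth_index z qt).
  by have := nth_last z t; rewrite -iq /= => ->; rewrite last_rcons.
have lt_side i j : j < size t ->
    ((nth z t j).1 \in [set w | index w [seq p.1 | p <- t] <= i]) = (j <= i).
  by move=> jt; rewrite inE -(nth_map z v) // index_uniq ?size_map.
apply/forall_inP=> f fC; have [i [it fE]] := memt f fC; apply/existsP.
(* Vertices off the cycle have index [size t], hence lie outside this side. *)
exists [set w | index w [seq p.1 | p <- t] <= i].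
apply/eqP/setP=> g; rewrite in_setI in_set1.
have nthV j : j.+1 < size t ->
    ((nth z t j).2 \in delta [set w | index w [seq p.1 | p <- t] <= i])
    = (j == i).
  move=> jt; have jst := elimT (sortedP z) srt j jt.
  rewrite (joins_delta _ jst) !lt_side //; lia.
apply/andP/eqP=> [[gY /memt[j [jt gE]]]|->].
  by move: gY; rewrite gE fE nthV // => /eqP->.
by split=> //; rewrite fE nthV.
Qed.

End Forests.

(** * Independence in $J_0$ and in the join matroid *)

Section JoinMatroid.
Variables (G : graph) (L : {set {set edge G}}) (J0 : matroid (option (edge G))).
Hypotheses (HL : linear_class L) (HLnontriv : ~~ trivial_class L) (HJ0 : is_J0 L J0).
Implicit Types (e : edge G) (F B C : {set edge G}).

Lemma mem_Some_imset F e : (Some e \in Some @: F) = (e \in F).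
Proof. by rewrite mem_imset // => x y []. Qed.

Lemma None_notin_imset F : None \notin Some @: F.
Proof. by apply/imsetP=> -[]. Qed.

Lemma bond_cocircuit B : bond B ->
  exists D, [/\ cocircuit J0 D, (None \in D) = (B \notin L) &
                forall e, (Some e \in D) = (e \in B)].
Proof.
move=> bB; have [BL|BL] := boolP (B \in L).
  exists (Some @: B); split; first 1 last.
  - exact/negbTE/None_notin_imset.
  - by move=> e; rewrite mem_Some_imset.
  by rewrite HJ0; apply/or3P/Or31/exists_inP; exists B.
exists (None |: Some @: B); split; first 1 last.
- by rewrite setU11.
- by move=> e; rewrite in_setU1 mem_Some_imset.
by rewrite HJ0; apply/or3P/Or32/existsP; exists B; rewrite bB BL eqxx.
Qed.

(** Every kind of cocircuit is, apart from $e_0$, a union of edge cuts; the cut through [e] contains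
    a bond through [e]. *)
Lemma cocircuit_bond D e : cocircuit J0 D -> Some e \in D ->
  exists B, [/\ bond B, e \in B & forall f, f \in B -> Some f \in D].
Proof.
rewrite HJ0 => cD eD.
suff [C [cutC eC sCD]] :
    exists C, [/\ edge_cut C, e \in C & forall f, f \in C -> Some f \in D].
  have [B [bB eB /subsetP sBC]] := edge_cut_bond cutC eC.
  by exists B; split=> // f /sBC/sCD.
have cutL B : B \in L -> edge_cut B.
  by have /andP[/forall_inP bL _] := HL; move/bL/bond_cut.
case/or3P: cD => [/exists_inP[B /cutL cB]|/existsP[B /and3P[bB _]]|].
- move=> /eqP DE; move: eD; rewrite DE mem_Some_imset => eB.
  by exists B; split=> // f; rewrite mem_Some_imset.
- move=> /eqP DE; move: eD; rewrite DE in_setU1 mem_Some_imset /= => eB.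
  exists B; split=> //; first exact: bond_cut.
  by move=> f; rewrite in_setU1 mem_Some_imset.
move=> /existsP[A /and3P[AE _ /eqP DE]]; move: eD; rewrite DE mem_Some_imset.
suff sub : e \in A -> exists C, [/\ edge_cut C, e \in C & C \subset A].
  move=> /sub[C [cutC eC /subsetP sCA]]; exists C; split=> // f /sCA fA.
  by rewrite mem_Some_imset.
case/orP: AE => [/existsP[P /andP[_ /eqP->]] /bigcupP[X XP eX]|].
  exists (delta X); split=> //; last exact: bigcup_sup XP.
  by apply/existsP; exists X.
case/andP=> /existsP[B1 /existsP[B2 /andP[/and3P[b1 b2 _] /eqP->]]] _.
case/setUP=> eB; [exists B1|exists B2]; split=> //; try exact: bond_cut.
  exact: subsetUl.
exact: subsetUr.
Qed.

(** A cocircuit that meets [F] in [e] alone shrinks to such a bond, and a cut that does so contains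
    such a bond, which yields a cocircuit. *)
Lemma indep_J0_forest F : indep J0 (Some @: F) <-> is_forest F.
Proof.
split=> [/indep_cocircuitP cocF|/forestP/forall_inP forF].
  apply/forestP/forall_inP=> e eF.
  have [|D cD DF] := cocF (Some e); first by rewrite mem_Some_imset.
  have /setIP[eD _] : Some e \in D :&: Some @: F by rewrite DF set11.
  have [B [/bond_cut/existsP[Y /eqP YB] eB sBD]] := cocircuit_bond cD eD.
  apply/existsP; exists Y; rewrite -YB; apply/eqP/setP=> f.
  rewrite in_setI in_set1; have [->|fe] := eqVneq f e; first by rewrite eB.
  apply/andP=> -[/sBD fD fF]; have : Some f \in D :&: Some @: F.
    by rewrite in_setI fD mem_Some_imset.
  by rewrite DF in_set1 => /eqP[fe']; rewrite fe' eqxx in fe.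
apply/indep_cocircuitP=> _ /imsetP[e eF ->].
have /existsP[Y /eqP YF] := forF e eF.
have eY : e \in delta Y by move/setP/(_ e): YF; rewrite in_setI set11 => /andP[].
have cutY : edge_cut (delta Y) by apply/existsP; exists Y.
have [B [bB eB /subsetP sBY]] := edge_cut_bond cutY eY.
have [D [cD _ DE]] := bond_cocircuit bB; exists D => //.
apply/setP=> -[f|]; last first.
  by rewrite in_setI (negbTE (None_notin_imset _)) andbF in_set1.
rewrite in_setI mem_Some_imset DE in_set1; apply/andP/eqP=> [[/sBY fY fF]|[->//]].
by congr Some; apply/set1P; rewrite -YF in_setI fY.
Qed.

Lemma indep_J0_None F :
  (exists2 D, cocircuit J0 D & D :&: (None |: Some @: F) = [set None]) <->
  ~ cobalanced L (components F).
Proof.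
split=> [[D cD DF] /cobalancedP cob|].
  have /setIP[ND _] : None \in D :&: (None |: Some @: F) by rewrite DF set11.
  move: cD; rewrite HJ0 => /or3P[/exists_inP[B _]|/existsP[B]|/existsP[B]].
  - by move=> /eqP DE; rewrite DE (negbTE (None_notin_imset _)) in ND.
  - move=> /and3P[bB /negP BL /eqP DE]; case: BL; apply: cob => //.
    apply/setP=> e; move/setP/(_ (Some e)): DF.
    by rewrite DE !in_setI !in_setU1 !mem_Some_imset !inE.
  by move=> /and3P[_ _ /eqP DE]; rewrite DE (negbTE (None_notin_imset _)) in ND.
move=> /negP/forall_inPn[B /andP[bB]]; rewrite bond_Ext // => /eqP BF BL.
have [D [cD ND DE]] := bond_cocircuit bB; exists D => //.
apply/setP=> -[e|]; last by rewrite !inE ND BL.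
rewrite in_setI in_setU1 mem_Some_imset DE /=.
by move/setP/(_ e): BF; rewrite !inE.
Qed.

Lemma indep_join F :
  indep (contract J0) F <-> is_forest F /\ ~ cobalanced L (components F).
Proof.
(* Every bond avoids the empty set, so non-triviality of [L] is what keeps $e_0$ from being a
   loop. *)
have cF0 : ~ cobalanced L (components set0).
  move=> /cobalancedP cob; case/negP: HLnontriv; apply/forall_inP=> B bB.
  by apply: cob => //; rewrite setI0.
have rk0 : indep J0 [set None].
  have -> : [set None] = None |: Some @: (set0 : {set edge G}).
    by rewrite imset0 setU0.
  apply: (indep_setU1P J0 (None_notin_imset set0)).2; split.
    apply: (indep_J0_forest set0).2; apply/forestP/forall_inP=> e.
    by rewrite inE.
  exact: (indep_J0_None set0).2.
rewrite (indep_contract F rk0).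
have indepU := indep_setU1P J0 (None_notin_imset F).
split=> [/indepU.1[/indep_J0_forest forF /indep_J0_None]|] //.
by case=> forF ncob; apply: indepU.2; split; [apply/indep_J0_forest|
  apply/indep_J0_None].
Qed.

(** Subsets of a forest are forests, and for forests dependent means cobalanced; so both minimality
    conditions agree. *)
Lemma is_join_circuit C :
  is_join L C <-> is_forest C /\ circuit (contract J0) C.
Proof.
have subF F : is_forest C -> F \subset C -> is_forest F.
  by move=> forC sFC C' cC' sC'F; apply: (forC C' cC'); apply: subset_trans sFC.
have cobI F : is_forest F -> ~~ indep (contract J0) F ->
    cobalanced L (components F).
  move=> forF; apply: contraNT => /negP ncob; exact: (indep_join F).2.
have cobD F : cobalanced L (components F) -> ~~ indep (contract J0) F.
  by move=> cobF; apply/negP=> /(indep_join F).1[].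
split=> [[forC cobC minC]|[forC /minsetP[depC minC]]].
  split; first by [].
  apply/minsetP; split=> [|F depF sFC]; first exact: cobD.
  have forF := subF F forC sFC.
  by apply: (minC F forF _ sFC); apply: cobI.
split=> [||F forF cobF sFC]; [exact: forC|exact: cobI|].
by apply: (minC F _ sFC); apply: cobD.
Qed.

End JoinMatroid.

(** * Circuits as joins and as cycles without joins *)

Theorem theorem3p10 (G : graph) (L : {set {set edge G}})
    (J0 : matroid (option (edge G)))
    (HL : linear_class L) (HLnontriv : ~~ trivial_class L)
    (HJ0 : is_J0 L J0) :
  forall C : {set edge G},
    circuit (contract J0) C <->
    (is_join L C \/
     (is_cycle C /\ ~ exists J : {set edge G}, is_join L J /\ J \subset C)).
Proof.
have joinP := is_join_circuit HL HLnontriv HJ0.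
have depC C : is_cycle C -> ~~ indep (contract J0) C.
  move=> cC; apply/negP=> /(indep_join HL HLnontriv HJ0)[forC _].
  exact: forC cC (subxx C).
move=> C; split=> [circC|[/joinP[]//|[cC noJ]]].
  have [/forestP forC|] := boolP (forestb C); first by left; apply/joinP.
  move=> nforC; right; have [depCC minC] := minsetP circC.
  (* A join inside the circuit [C] is dependent, so it would equal [C] and make [C] a forest. *)
  split=> [|[J [/joinP[forJ /minsetP[depJ _]] sJC]]]; last first.
    by case/negP: nforC; rewrite -(minC J depJ sJC); apply/forestP.
  have [C' cC' sC'C] := not_forestb_cycle nforC.
  by rewrite -(minC C' (depC C' cC') sC'C).
(* A circuit [F] inside the cycle is not a forest, as it would be a join; proper subsets of a cycle
   are forests, so [F] is all of [C]. *)
have [F circF sFC] :=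
  @minset_exists _ (fun X => ~~ indep (contract J0) X) C (depC C cC).
have [|nforF] := boolP (forestb F).
  by move/forestP=> forF; case: noJ; exists F; split=> //; apply/joinP.
suff <- : F = C by [].
apply/eqP; rewrite eqEsubset sFC; apply/subsetP=> e eC; apply: contraR nforF.
move=> eF; apply: forestb_sub (cycle_minimal cC eC).
by rewrite subsetD1 sFC.
Qed.
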